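(* Let $\mathbb S$ be the free semigroup action on the compact metric space $(X,d)$ generated by continuous maps $g_1,\dots,g_p$, and let $\nu\in\mathcal M_1(X)$ with $\Pi(\sigma,\nu)_{erg}\neq\emptyset$. Then $$\liminf_{\varepsilon\to0}\,\inf\{S_d(K,\mathbb S,\varepsilon):K\in\mathcal B_X,\ \nu(K)>0\}\ \ge\ h_\nu(\mathbb S).$$ In particular, $h_{top}(K,\mathbb S)\ge h_\nu(\mathbb S)$ for every Borel set $K\subset X$ with $\nu(K)>0$.
   Context: Setting: $(X,d)$ compact metric space, $g_1,\dots,g_p:X\to X$ continuous, $G_n^*$ the set of all words $\underline g=g_{i_n}\cdots g_{i_1}$, $i_j\in\{1,\dots,p\}$ ($p^n$ words). $d_{\underline g}(x,y)=\max_{0\le j\le n}d(g_{i_j}\cdots g_{i_1}x,g_{i_j}\cdots g_{i_1}y)$. $s(K,\underline g,\varepsilon)$: maximal cardinality of a subset of $K$ whose distinct points are at $d_{\underline g}$-distance $>\varepsilon$. $S_n(K,\mathbb S,\varepsilon)=p^{-n}\sum_{\underline g\in G_n^*}s(K,\underline g,\varepsilon)$, $S_d(K,\mathbb S,\varepsilon)=\limsup_{n\to\infty}\frac1n\log S_n(K,\mathbb S,\varepsilon)$, $h_{top}(K,\mathbb S)=\lim_{\varepsilon\to0}S_d(K,\mathbb S,\varepsilon)$. $\mathcal B_X$ is the Borel $\sigma$-algebra. Skew product: $\Sigma_p^+=\{1,\dots,p\}^{\mathbb N}$, shift $\sigma$, $\mathcal F_G(\omega,x)=(\sigma\omega,g_{\omega_1}(x))$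 on $\Sigma_p^+\times X$. $\Pi(\sigma,\nu)$: $\mathcal F_G$-invariant Borel probabilities $\mu$ on $\Sigma_p^+\times X$ with $(\pi_{\Sigma_p^+})_*\mu$ $\sigma$-invariant and $(\pi_X)_*\mu=\nu$; $\Pi(\sigma,\nu)_{erg}$ its ergodic elements. $h_\nu(\mathbb S)=\sup_{\mu\in\Pi(\sigma,\nu)}h_\mu(\mathcal F_G)-\log p$. *)

(* Defs.v *)
From HB Require Import structures.
From mathcomp Require Import all_boot all_order all_algebra.
From mathcomp Require Import all_classical all_reals all_analysis.

Set Implicit Arguments.
Unset Strict Implicit.
Unset Printing Implicit Defensive.

Import Order.TTheory GRing.Theory Num.Theory.
Import numFieldTopology.Exports.
Local Open Scope classical_set_scope.
Local Open Scope ring_scope.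

Section MetricDefs.
Context {R : realType} {X : Type} (d : X -> X -> R).

Definition is_metric : Prop :=
  [/\ (forall x y, 0 <= d x y), (forall x y, d x y = 0 <-> x = y),
      (forall x y, d x y = d y x) & (forall x y z, d x z <= d x y + d y z)].

Definition dball (x : X) (r : R) : set X := [set y | d x y < r].

Definition dopen : set (set X) :=
  [set U | forall x, U x -> exists2 r, 0 < r & dball x r `<=` U].

Definition dcompact : Prop :=
  forall F : set (set X), F `<=` dopen -> \bigcup_(U in F) U = setT ->
    exists2 s : seq (set X), [set` s] `<=` F & \bigcup_(U in [set` s]) U = setT.

Definition dcontinuous (f : X -> X) : Prop :=
  forall x (e : R), 0 < e ->
    exists2 r : R, 0 < r & forall y, d x y < r -> d (f x) (f y) < e.

End MetricDefs.

Notation XB d := (g_sigma_algebraType (dopen d)).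

(* Sigma_p^+ = {1..p}^N is represented by nat -> 'I_p (symbols 0..p-1,
   coordinate omega_1 of the paper is [w 0]). Its Borel sigma-algebra
   (product topology) is the one generated by the cylinders. *)
(* 'I_q.+1 is inhabited (needed to build the measurable structure) *)
HB.instance Definition _ (q : nat) := isPointed.Build 'I_q.+1 ord0.

Definition cylinders (p : nat) : set (set (nat -> 'I_p)) :=
  [set A | exists (n : nat) (i : 'I_p), A = [set w | w n = i]].

Notation Sigma q := (g_sigma_algebraType (@cylinders q.+1)).

Definition shift {p : nat} (w : nat -> 'I_p) : nat -> 'I_p := fun n => w n.+1.

Section SemigroupTop.
Context {R : realType} {X : pointedType} (d : X -> X -> R) {p : nat}
  (g : 'I_p -> X -> X).

Definition orb (w : seq 'I_p) (x : X) : X := foldl (fun y i => g i y) x w.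

Definition dword (w : seq 'I_p) (x y : X) : R :=
  \big[Num.max/0]_(j < (size w).+1) d (orb (take j w) x) (orb (take j w) y).

Definition separated (K : set X) (w : seq 'I_p) (eps : R) (s : seq X) : Prop :=
  [/\ uniq s, (forall x, x \in s -> K x) &
      (forall x y, x \in s -> y \in s -> x != y -> eps < dword w x y)].

Definition sep_num (K : set X) (w : seq 'I_p) (eps : R) : \bar R :=
  ereal_sup [set ((size s)%:R)%:E | s in separated K w eps].

Definition S_n (K : set X) (eps : R) (n : nat) : \bar R :=
  ((p%:R ^- n)%:E * \sum_(w : n.-tuple 'I_p) sep_num K w eps)%E.

Definition S_d (K : set X) (eps : R) : \bar R :=
  limn_esup (fun n => (lne (S_n K eps n) * (n%:R^-1)%:E)%E).

Definition h_top (K : set X) : \bar R := lim (S_d K @ (0:R)^'+).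

End SemigroupTop.

Section KSEntropy.
Context {R : realType} {dT : measure_display} {T : measurableType dT}
  (mu : probability T R) (f : T -> T).

(* finite measurable partitions (listed as sequences; empty cells allowed) *)
Definition is_fpartition (P : seq (set T)) : Prop :=
  [/\ (forall A, A \in P -> measurable A),
      (forall i j, (i < size P)%N -> (j < size P)%N -> i != j ->
         nth set0 P i `&` nth set0 P j = set0) &
      \bigcup_(A in [set` P]) A = setT].

(* H_mu(P) = - sum_{A in P} mu(A) log mu(A)   (0 log 0 = 0) *)
Definition part_entropy (P : seq (set T)) : R :=
  \sum_(A <- P) - (fine (mu A) * ln (fine (mu A))).

Definition part_join (P Q : seq (set T)) : seq (set T) :=
  [seq A `&` B | A <- P, B <- Q].

Fixpoint iter_join (P : seq (set T)) (n : nat) : seq (set T) :=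
  match n with
  | 0 => [:: setT]
  | n.+1 => part_join (iter_join P n) [seq (iter n f) @^-1` A | A <- P]
  end.

(* h_mu(f, P) = lim_n (1/n) H_mu(P v ... v f^{-(n-1)} P) (limsup; the limit exists) *)
Definition entropy_part (P : seq (set T)) : \bar R :=
  limn_esup (fun n => (part_entropy (iter_join P n) / n%:R)%:E).

Definition ks_entropy : \bar R :=
  ereal_sup [set entropy_part P | P in is_fpartition].

End KSEntropy.

Section SkewProduct.
Context {R : realType} {X : pointedType} (d : X -> X -> R) {p : nat}
  (g : 'I_p.+1 -> X -> X).

Local Notation Omega := (Sigma p * XB d)%type.

Definition skew (z : Omega) : Omega := (shift z.1, g (z.1 0%N) z.2).

Definition Pi_set (nu : probability (XB d) R) : set (probability Omega R) :=
  [set mu | [/\ (forall C : set Omega, measurable C -> mu (skew @^-1` C) = mu C),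
     (forall B : set (Sigma p), measurable B ->
        mu (fst @^-1` (shift @^-1` B)) = mu (fst @^-1` B)) &
     (forall A : set (XB d), measurable A -> mu (snd @^-1` A) = nu A)]].

Definition Pi_erg (nu : probability (XB d) R) : set (probability Omega R) :=
  [set mu | Pi_set nu mu /\
     (forall C : set Omega, measurable C -> skew @^-1` C = C ->
        mu C = 0%E \/ mu C = 1%E)].

Definition h_nu (nu : probability (XB d) R) : \bar R :=
  (ereal_sup [set ks_entropy mu skew | mu in Pi_set nu] - (ln (p.+1)%:R)%:E)%E.

End SkewProduct.

(* Main.v *)
Require Import Defs.
From mathcomp Require Import all_boot all_order all_algebra.
From mathcomp Require Import all_classical all_reals all_analysis.
From mathcomp Require Import measurable_realfun lra.

Set Implicit Arguments.
Unset Strict Implicit.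
Unset Printing Implicit Defensive.

Import Order.TTheory GRing.Theory Num.Theory.
Import numFieldTopology.Exports.
Local Open Scope classical_set_scope.
Local Open Scope ring_scope.

(** Let [F] be the skew product, [mu] in Pi(sigma, nu), possibly not ergodic,
and [P] a finite partition.  Off a set [E] of small [mu]-measure, the [P]-cell of
a point only depends on finitely many symbols and on its position in [X] up to
some [delta].  Hence a Bowen ball of radius less than [delta / 2] determines the
[P]-itinerary of each of its points except at the times when that point
visits [E], so covering a set of large measure by [exp (a n)] such balls bounds
the entropy of the [n]-th join by roughly [a n]: compare [mu] with an explicit
distribution on itineraries through Gibbs' inequality.

To get such a cover from a set [K] of positive [nu]-measure, take an ergodic
[mu0] with the same marginal [nu].  Almost every [mu0]-orbit enters
[Sigma x K], so the images of [K] under the words of length at most [M] fill [X]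
up to [nu]-measure [eta], hence also up to [eta] for [mu].  A spanning set for
[K] and the word [w u] is carried by [w] to a spanning set for [w K] and the
word [u], so the images of [K] have the same exponential growth rate as [K].
Summing over the words of length [n] produces the term [log p]. *)

(** * Entropy of itineraries *)

(** Termwise, [ln x <= x - 1] at [x = q i / m i] gives [m i * (ln (q i) - ln (m i)) <= q i - m i],
    and these differences sum to at most 0. Comparing only total masses allows [q] to be a
    subprobability. *)
Lemma gibbs_inequality (R : realType) (I : Type) (s : seq I) (m q : I -> R) :
  (forall i, 0 <= m i) -> (forall i, 0 < q i) ->
  \sum_(i <- s) q i <= \sum_(i <- s) m i ->
  \sum_(i <- s) - (m i * ln (m i)) <= \sum_(i <- s) - ln (q i) * m i.
Proof.
move=> m0 q0 qm; rewrite -subr_le0 -sumrB.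
apply: (@le_trans _ _ (\sum_(i <- s) (q i - m i))); last first.
  by rewrite sumrB subr_le0.
apply: ler_sum => i _.
have := m0 i; rewrite le_eqVlt => /predU1P[<-|mi0].
  by rewrite !(mul0r, mulr0, oppr0, addr0) ltW.
have := le_ln1Dx (x := q i / m i - 1).
rewrite ltrBrDr addNr divr_gt0// addrCA subrr addr0 => /(_ isT).
rewrite ln_div ?posrE// => h.
have : m i * (ln (q i) - ln (m i)) <= m i * (q i / m i - 1).
  by rewrite ler_wpM2l// ltW.
rewrite [leRHS]mulrBr mulrCA divff ?gt_eqF// !mulr1; lra.
Qed.

(** Letters are appended at the end, in the order in which [iter_join] refines, so that [iter_joinE]
    is an equality of lists. *)
Fixpoint words (k n : nat) : seq (seq nat) :=
  if n is n'.+1 then [seq rcons w i | w <- words k n', i <- iota 0 k]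
  else [:: [::]].

Lemma size_words {k n : nat} {w : seq nat} : w \in words k n -> size w = n.
Proof.
elim: n w => [w|n IH w] /=; first by rewrite inE => /eqP ->.
by case/allpairsP => -[v i] [/= vn _ ->]; rewrite size_rcons (IH v).
Qed.

Lemma sum_words_prod (R : comNzRingType) (k n : nat) (F : nat -> nat -> R) :
  \sum_(w <- words k n) \prod_(j < n) F j (nth 0%N w j) =
  \prod_(j < n) \sum_(i <- iota 0 k) F j i.
Proof.
elim: n => [|n IH] /=; first by rewrite big_seq1 !big_ord0.
rewrite big_allpairs_dep big_ord_recr /= -IH mulr_suml big_seq [RHS]big_seq.
apply: eq_bigr => w /size_words wn; rewrite mulr_sumr; apply: eq_bigr => i _.
rewrite big_ord_recr /= nth_rcons wn ltnn eqxx; congr (_ * _).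
by apply: eq_bigr => j _; rewrite nth_rcons wn ltn_ord.
Qed.

(** This is [t] to the power of the Hamming distance, over the first [n] positions, between [w] and
    [r]. *)
Definition mismatch_weight (R : realType) (t : R) (n : nat) (r : nat -> nat)
    (w : seq nat) : R :=
  \prod_(j < n) (if nth 0%N w j == r j then 1 else t).

(** The sum factorises over positions; at each position at most one letter matches [r j], and every
    other letter weighs [t]. *)
Lemma sum_mismatch_weight (R : realType) (t : R) (k n : nat) (r : nat -> nat) :
  0 <= t -> \sum_(w <- words k n) mismatch_weight t n r w <= (1 + k%:R * t) ^+ n.
Proof.
move=> t0; rewrite /mismatch_weight.
rewrite (sum_words_prod k n (fun j i => if i == r j then 1 else t)).
rewrite -[n in leRHS]card_ord -prodr_const; apply: ler_prod => j _.
apply/andP; split; first by apply: sumr_ge0 => i _; case: ifP.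
apply: (@le_trans _ _ (\sum_(i <- iota 0 k) ((i == r j)%:R + t))).
  apply: ler_sum => i _; case: eqP => _; rewrite ?lerDl// ?add0r//.
rewrite big_split /= lerD//.
  have -> : \sum_(i <- iota 0 k) (i == r j)%:R = (count_mem (r j) (iota 0 k))%:R :> R.
    rewrite -sum1_count natr_sum [RHS]big_mkcond.
    by apply: eq_bigr => i _ /=; case: eqP.
  by rewrite lern1 count_uniq_mem ?iota_uniq// leq_b1.
by rewrite big_const_seq count_predT size_iota iter_addr_0 mulr_natl.
Qed.

Section Itineraries.
Context {R : realType} {dT : measure_display} {T : measurableType dT}.
Variables (mu : probability T R) (f : T -> T) (P : seq (set T)).
Hypotheses (mf : measurable_fun setT f) (Ppart : is_fpartition P).
Hypothesis (fmu : forall C, measurable C -> mu (f @^-1` C) = mu C).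

Definition cell (w : seq nat) : set T :=
  [set z | forall j, (j < size w)%N -> nth set0 P (nth 0%N w j) (iter j f z)].

Lemma cell_rcons (w : seq nat) (i : nat) :
  cell (rcons w i) = cell w `&` (iter (size w) f @^-1` nth set0 P i).
Proof.
apply/seteqP; split => z /=.
  move=> h; split => [j jw|].
    by have := h j; rewrite size_rcons nth_rcons jw; apply; exact: ltnW.
  by have := h (size w); rewrite size_rcons nth_rcons ltnn eqxx; apply.
move=> [h1 h2] j; rewrite size_rcons ltnS leq_eqVlt => /predU1P[->|jw].
  by rewrite nth_rcons ltnn eqxx.
by rewrite nth_rcons jw; exact: h1.
Qed.

Lemma iter_joinE (n : nat) : iter_join f P n = [seq cell w | w <- words (size P) n].
Proof.
elim: n => [|n IH] /=.
  by congr cons; apply/seteqP; split => z.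
rewrite IH /part_join allpairs_mapl map_allpairs.
rewrite -[in LHS](mkseq_nth set0 P) /mkseq -map_comp allpairs_mapr.
rewrite size_map size_iota; apply/eq_in_allpairs => w i /size_words wn _ /=.
by rewrite cell_rcons wn.
Qed.

Lemma measurable_iter (j : nat) (A : set T) : measurable A -> measurable (iter j f @^-1` A).
Proof.
move=> mA; elim: j => //= j IH.
have -> : (fun x => f (iter j f x)) @^-1` A = iter j f @^-1` (f @^-1` A) by [].
elim: j A mA {IH} => [|j IH] A mA /=.
  by rewrite -[X in measurable X]setTI; exact: mf.
apply: (IH (f @^-1` A)); rewrite -[X in measurable X]setTI; exact: mf.
Qed.

Lemma measure_iter (j : nat) (A : set T) :
  measurable A -> mu (iter j f @^-1` A) = mu A.
Proof.
elim: j A => //= j IH A mA.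
have -> : (fun x => f (iter j f x)) @^-1` A = iter j f @^-1` (f @^-1` A) by [].
by rewrite IH ?fmu//; exact: (measurable_iter 1).
Qed.

Lemma measurable_part (i : nat) : measurable (nth set0 P i).
Proof.
case: Ppart => mP _ _; case: (ltnP i (size P)) => h.
  by apply: mP; exact: mem_nth.
by rewrite nth_default.
Qed.

Lemma measurable_cell (w : seq nat) : measurable (cell w).
Proof.
elim/last_ind: w => [|w i IH].
  by rewrite (_ : cell [::] = setT)//; apply/seteqP; split => z.
rewrite cell_rcons; apply: measurableI => //.
by apply: measurable_iter; exact: measurable_part.
Qed.

Lemma part_index : exists idx : T -> nat, forall z,
  [/\ (idx z < size P)%N, nth set0 P (idx z) z &
      forall i, (i < size P)%N -> nth set0 P i z -> i = idx z].
Proof.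
suff /choice[idx h] : forall z, exists i, [/\ (i < size P)%N, nth set0 P i z &
    forall i', (i' < size P)%N -> nth set0 P i' z -> i' = i] by exists idx.
move=> z; case: Ppart => _ disj cov.
have [A AP Az] : (\bigcup_(A in [set` P]) A) z by rewrite cov.
exists (index A P); split; rewrite ?index_mem ?nth_index// => i iP Piz.
apply/eqP/negP => /negP ne; have := disj _ _ iP _ ne; rewrite index_mem => /(_ AP).
by rewrite nth_index// => h; have : set0 z by rewrite -h.
Qed.

Section WithIndex.
Variable idx : T -> nat.
Hypothesis idxP : forall z,
  [/\ (idx z < size P)%N, nth set0 P (idx z) z &
      forall i, (i < size P)%N -> nth set0 P i z -> i = idx z].

Definition itinerary (n : nat) (z : T) : seq nat :=
  mkseq (fun j => idx (iter j f z)) n.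

Lemma sum_part_indic (phi : nat -> R) (z : T) :
  \sum_(i <- iota 0 (size P)) phi i * \1_(nth set0 P i) z = phi (idx z).
Proof.
have [iP Pz u] := idxP z.
rewrite (bigD1_seq (idx z)) ?iota_uniq ?mem_iota//= indicE mem_set// mulr1.
rewrite big_seq_cond big1 ?addr0// => i; rewrite mem_iota add0n => /andP[iP' ne].
rewrite indicE memNset ?mulr0// => /(u _ iP') e; by rewrite e eqxx in ne.
Qed.

(** Among the cells of the join, only that of its own itinerary contains [z]. Writing a function of
    the itinerary as a combination of cell indicators also gives its measurability, [idx] being
    merely a chosen function. *)
Lemma sum_cell_indic (n : nat) (phi : seq nat -> R) (z : T) :
  \sum_(w <- words (size P) n) phi w * \1_(cell w) z = phi (itinerary n z).
Proof.
elim: n phi => [|n IH] phi /=.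
  by rewrite big_seq1 indicE mem_set ?mulr1.
rewrite big_allpairs_dep /itinerary mkseqS.
rewrite -(IH (fun w => phi (rcons w (idx (iter n f z))))).
rewrite big_seq [RHS]big_seq; apply: eq_bigr => w /size_words wn.
rewrite -(sum_part_indic (fun i => phi (rcons w i))) mulr_suml.
apply: eq_bigr => i _; rewrite cell_rcons wn indicI /= mulrAC -mulrA; congr (_ * _).
Qed.

Lemma integral_itinerary (n : nat) (phi : seq nat -> R) : (forall w, 0 <= phi w) ->
  (\int[mu]_z (phi (itinerary n z))%:E)%E =
  (\sum_(w <- words (size P) n) phi w * fine (mu (cell w)))%:E.
Proof.
move=> phi0.
under eq_integral => z _ do rewrite -sum_cell_indic -sumEFin.
rewrite ge0_integral_sum//; last 2 first.
- move=> w; apply/measurable_EFinP; apply: measurable_funM => //.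
  exact: measurable_indic (measurable_cell _).
- by move=> w z _; rewrite lee_fin mulr_ge0.
rewrite -sumEFin; apply: eq_bigr => w _.
under eq_integral => z _ do rewrite EFinM.
rewrite ge0_integralZl//; last 2 first.
- by apply/measurable_EFinP; exact: measurable_indic (measurable_cell _).
- by rewrite lee_fin.
rewrite integral_indic ?setIT//; last exact: measurable_cell.
by rewrite EFinM fineK// fin_num_measure//; exact: measurable_cell.
Qed.

End WithIndex.

(** A time outside [E] contributes a factor 1 and a visit to [E] at least [t]; the left side is [t]
    to the number of visits. *)
Lemma mismatch_weight_itinerary (idx : T -> nat) (E : set T) (t : R) (n : nat)
    (r : nat -> nat) (z : T) : 0 < t <= 1 ->
  (forall j, (j < n)%N -> ~ E (iter j f z) -> idx (iter j f z) = r j) ->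
  expR (ln t * \sum_(j < n) \1_E (iter j f z)) <=
  mismatch_weight t n r (itinerary idx n z).
Proof.
move=> /andP[t0 t1] h; rewrite mulr_sumr expR_sum; apply: ler_prod => j _.
rewrite expR_ge0 /= nth_mkseq// indicE; case: (asboolP (E (iter j f z))) => Ez.
  by rewrite mem_set// mulr1 lnK ?posrE//; case: ifP.
by rewrite memNset// mulr0 expR0 h// eqxx.
Qed.

Lemma integral_visits (E G : set T) (n : nat) (a b c : R) :
  measurable E -> measurable G -> 0 <= a -> 0 <= b -> 0 <= c ->
  (\int[mu]_z (a + b * (\sum_(j < n) \1_E (iter j f z)) + c * \1_G z)%:E)%E =
  (a + b * (n%:R * fine (mu E)) + c * fine (mu G))%:E.
Proof.
move=> mE mG a0 b0 c0.
have mEj j : measurable_fun setT (fun z => \1_E (iter j f z) : R).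
  exact: (measurable_indic (measurable_iter j mE)).
have mS : measurable_fun setT (fun z => \sum_(j < n) \1_E (iter j f z) : R).
  by apply: measurable_sum.
have mG1 : measurable_fun setT (\1_G : T -> R) by exact: measurable_indic.
under eq_integral => z _ do rewrite !EFinD !EFinM.
rewrite ge0_integralD//; last 4 first.
- move=> z _; rewrite adde_ge0 ?lee_fin// mulr_ge0// sumr_ge0//.
- apply: emeasurable_funD => //.
  by apply/measurable_EFinP; apply: measurable_funM.
- by move=> z _; rewrite -EFinM lee_fin mulr_ge0.
- by apply/measurable_EFinP; apply: measurable_funM.
rewrite ge0_integralD//; last 2 first.
- by move=> z _; rewrite -EFinM lee_fin mulr_ge0// sumr_ge0.
- by apply/measurable_EFinP; apply: measurable_funM.
rewrite integral_cst//.
rewrite ge0_integralZl//; last 2 first.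
- by apply/measurable_EFinP.
- by move=> z _; rewrite lee_fin sumr_ge0.
rewrite ge0_integralZl//; last 1 first.
- by apply/measurable_EFinP.
rewrite integral_indic// setIT.
under eq_integral => z _ do rewrite -sumEFin.
rewrite ge0_integral_sum//; last 1 first.
  by move=> j; apply/measurable_EFinP.
rewrite (eq_bigr (fun=> (fine (mu E))%:E)); last first.
  move=> j _; rewrite (integral_indic mu measurableT (measurable_iter j mE)) setIT.
  by rewrite [LHS]measure_iter// fineK// fin_num_measure.
rewrite sumEFin sumr_const card_ord -[_ *+ n]mulr_natl -[X in (c%:E * X)%E]fineK ?fin_num_measure//.
rewrite !EFinD !EFinM; congr (_ + _ + _)%E.
by rewrite -[RHS]mule1; congr (_ * _)%E; exact: probability_setT.
Qed.

(** Here [s] indexes the balls, [r i] is the itinerary predicted by ball [i], [G] is the covered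
    set, and predictions may fail only during visits to [E]. Gibbs' inequality bounds the entropy by
    the mean of [- ln q] along itineraries, which is then estimated pointwise. The parameter [t]
    prices a mismatch: [(size P)%:R * t] pays for normalisation, [- ln t * fine (mu E)] for the
    expected visits. *)
Lemma part_entropy_le_cover (I : eqType) (s : seq I) (r : I -> nat -> nat)
    (E G : set T) (t : R) (n : nat) :
  measurable E -> measurable G -> 0 < t <= 1 -> (0 < size s)%N ->
  (forall z, G z -> exists2 i, i \in s & forall j, (j < n)%N ->
     ~ E (iter j f z) -> nth set0 P (r i j) (iter j f z)) ->
  part_entropy mu (iter_join f P n) <=
    ln 2 + ln (size s)%:R + n%:R * ((size P)%:R * t - ln t * fine (mu E))
    + n%:R * ln (size P)%:R * fine (mu (~` G)).
Proof.
move=> mE mG /[dup] t01 /andP[t0 t1] s0 cov.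
have [idx idxP] := part_index.
set k := size P.
have k0 : (0 < k)%N by have [h _ _] := idxP point; exact: leq_ltn_trans h.
have k1 : 1 <= k%:R :> R by rewrite ler1n.
have kR0 : 0 < k%:R :> R by rewrite ltr0n.
have N1 : 1 <= (size s)%:R :> R by rewrite ler1n.
have N0 : 0 < (size s)%:R :> R by rewrite ltr0n.
have kt0 : 0 <= k%:R * t by rewrite mulr_ge0// ltW.
(* [Z] bounds the total mass of [M] over all words, by [sum_mismatch_weight] applied to each element
   of [s]. *)
pose Z : R := (size s)%:R * (1 + k%:R * t) ^+ n.
have Z0 : 0 < Z by rewrite mulr_gt0// exprn_gt0// ltr_wpDr.
pose M w : R := \sum_(i <- s) mismatch_weight t n (r i) w.
have mw0 i w : 0 <= mismatch_weight t n (r i) w.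
  by apply: prodr_ge0 => j _; case: ifP => // _; exact: ltW.
have mw1 i w : mismatch_weight t n (r i) w <= 1.
  apply: (@le_trans _ _ (\prod_(j < n) 1)); last by rewrite big1.
  by apply: ler_prod => j _; case: ifP; rewrite ?ler01 ?lexx ?t1 ?ltW.
have M0 w : 0 <= M w by apply: sumr_ge0.
(* The uniform distribution on itineraries controls the points outside [G]; the
   other half favours the itineraries close to one of the [r i]. *)
pose q w : R := (k%:R ^- n + M w / Z) / 2.
have q0 w : 0 < q w.
  by rewrite divr_gt0// ltr_wpDr// ?divr_ge0 ?invr_gt0 ?exprn_gt0// ltW.
have MZ w : M w <= Z.
  apply: (@le_trans _ _ (size s)%:R).
    by rewrite -sum1_size natr_sum; exact: ler_sum.
  by apply: ler_peMr; [exact: ltW|rewrite exprn_ege1// lerDl].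
(* This makes [- ln (q w)] nonnegative, as the integrals of nonnegative functions below require. *)
have q1 w : q w <= 1.
  rewrite ler_pdivrMr// mul1r -[2]/(1 + 1) lerD//.
    by rewrite invf_le1 ?exprn_gt0// exprn_ege1.
  by rewrite ler_pdivrMr// mul1r.
have szw : size (words k n) = (k ^ n)%N.
  elim: (n) => //= n' IH; by rewrite size_allpairs IH size_iota expnSr.
have summu : \sum_(w <- words k n) fine (mu (cell w)) = 1.
  have := @integral_itinerary idx idxP n (fun=> 1) (fun=> ler01).
  rewrite integral_cst//= [X in (_ * X)%E](@probability_setT _ _ _ mu) mule1 => -[->].
  by apply: eq_bigr => w _; rewrite mul1r.
have sumq : \sum_(w <- words k n) q w <= \sum_(w <- words k n) fine (mu (cell w)).
  rewrite summu -mulr_suml ler_pdivrMr// mul1r -[2]/(1 + 1) big_split /= lerD//.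
    rewrite big_const_seq count_predT szw iter_addr_0 -[leLHS]mulr_natl natrX divff//.
    by rewrite gt_eqF// exprn_gt0.
  rewrite -mulr_suml ler_pdivrMr// mul1r exchange_big /=.
  apply: (@le_trans _ _ (\sum_(i <- s) (1 + k%:R * t) ^+ n)).
    by apply: ler_sum => i _; apply: sum_mismatch_weight; exact: ltW.
  by rewrite big_const_seq count_predT iter_addr_0 -[leLHS]mulr_natl.
rewrite /part_entropy iter_joinE big_map -/k.
apply: (le_trans (gibbs_inequality _ q0 sumq)); first by move=> w; exact: fine_ge0.
have lnt : 0 <= - ln t by rewrite oppr_ge0 ln_le0.
have lnk : 0 <= ln k%:R :> R by exact: ln_ge0.
pose a : R := ln 2 + ln (size s)%:R + n%:R * (k%:R * t).
have a0 : 0 <= a by rewrite !addr_ge0 ?ln_ge0 ?mulr_ge0// ?ler1n// ltW.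
suff : (\int[mu]_z (- ln (q (itinerary idx n z)))%:E <=
    \int[mu]_z (a + (- ln t) * (\sum_(j < n) \1_E (iter j f z))
      + (n%:R * ln k%:R) * \1_(~` G) z)%:E)%E.
  rewrite (@integral_itinerary idx idxP n (fun w => - ln (q w))); last by move=> w; rewrite oppr_ge0 ln_le0.
  rewrite integral_visits//; last 2 first.
  - exact: measurableC.
  - by rewrite mulr_ge0.
  rewrite lee_fin => /le_trans; apply; rewrite /a; lra.
apply: ge0_le_integral => //.
- by move=> z _; rewrite lee_fin oppr_ge0 ln_le0.
- under eq_fun => z do rewrite -(sum_cell_indic idxP n (fun w => - ln (q w))).
  apply/measurable_EFinP; apply: measurable_sum => w.
  by apply: measurable_funM => //; exact: measurable_indic (measurable_cell _).
- apply/measurable_EFinP; apply: measurable_funD; last first.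
    by apply: measurable_funM => //; apply: measurable_indic; exact: measurableC.
  apply: measurable_funD => //; apply: measurable_funM => //.
  apply: measurable_sum => j.
  exact: (measurable_indic (measurable_iter j mE)).
move=> z _; rewrite lee_fin.
have S0 : 0 <= \sum_(j < n) \1_E (iter j f z) :> R by apply: sumr_ge0.
set S := \sum_(j < n) _ in S0 *.
(* On [G], keep in [q] only the term of a ball covering [z]; off [G], keep only the uniform part, at
   a cost of [n%:R * ln k%:R]. *)
have [Gz|Gz] := pselect (G z).
  rewrite indicE memNset ?mulr0 ?addr0; last by move=> /=; apply.
  have [i si ri] := cov z Gz.
  have : expR (ln t * S) / Z / 2 <= q (itinerary idx n z).
    rewrite ler_pM2r ?invr_gt0// ler_wpDl// ?invr_ge0 ?exprn_ge0//.
    rewrite ler_pM2r ?invr_gt0//.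
    apply: (@le_trans _ _ (mismatch_weight t n (r i) (itinerary idx n z))).
      apply: mismatch_weight_itinerary => // j jn nE.
      have h := ri j jn nE; have [_ _ u] := idxP (iter j f z).
      apply/esym/u => //; rewrite ltnNge; apply/negP => ge.
      by rewrite nth_default in h.
    rewrite /M (big_rem i)//= lerDl; exact: sumr_ge0.
  rewrite -ler_ln ?posrE// ?divr_gt0 ?expR_gt0//.
  rewrite ln_div ?posrE ?divr_gt0 ?expR_gt0// ln_div ?posrE ?expR_gt0// expRK.
  rewrite {1}/Z lnM ?posrE//; last first.
    by rewrite exprn_gt0// ltr_wpDr.
  rewrite lnXn ?ltr_wpDr// -[_ *+ n]mulr_natl.
  have : n%:R * ln (1 + k%:R * t) <= n%:R * (k%:R * t).
    by rewrite ler_wpM2l// le_ln1Dx// (lt_le_trans _ kt0)// ltrN10.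
  rewrite /a; lra.
rewrite indicE mem_set// mulr1.
have : k%:R ^- n / 2 <= q (itinerary idx n z).
  by rewrite ler_pM2r ?invr_gt0// lerDl divr_ge0// ltW.
rewrite -ler_ln ?posrE// ?divr_gt0 ?invr_gt0 ?exprn_gt0//.
rewrite ln_div ?posrE ?invr_gt0 ?exprn_gt0// lnV ?posrE ?exprn_gt0// lnXn// -[_ *+ n]mulr_natl.
have : 0 <= - ln t * S by rewrite mulr_ge0.
have : 0 <= ln (size s)%:R :> R by rewrite ln_ge0.
have : 0 <= n%:R * (k%:R * t) by rewrite mulr_ge0.
rewrite /a; lra.
Qed.

End Itineraries.

(** * Local constancy of measurable sets of the skew product *)

(** The remainders decrease to the empty set, so continuity from above applies to the finite measure
    [mu]. *)
Lemma measure_tail_bigcup (R : realType) (dT : measure_display) (T : measurableType dT)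
    (mu : probability T R) (A : nat -> set T) (e : R) :
  (forall n, measurable (A n)) -> 0 < e ->
  exists m, (mu (\bigcup_n A n `\` \bigcup_(j < m) A j) <= e%:E)%E.
Proof.
move=> mA e0; pose F m := \bigcup_n A n `\` \bigcup_(j < m) A j.
have mF m : measurable (F m).
  by apply: measurableD; apply: bigcup_measurable.
have F0 : \bigcap_m F m = set0.
  apply/seteqP; split => // x Fx; have [[n _ Anx] _] := Fx 0%N I.
  by have [_] := Fx n.+1 I; apply; exists n => //=.
have Fle : {homo F : n m / (n <= m)%N >-> (m <= n)%O}.
  move=> n m nm; apply/subsetPset => x [xA xn]; split => // -[j /= jn Ajx].
  by apply: xn; exists j => //=; exact: leq_trans jn nm.
have F0y : (mu (F 0%N) < +oo)%E := le_lt_trans (probability_le1 mu (mF 0%N)) (ltry 1).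
have mF0 : measurable (\bigcap_m F m) by rewrite F0.
have h := nonincreasing_cvg_mu F0y mF mF0 Fle; rewrite F0 measure0 in h.
have [m _ /(_ m (leqnn m)) /= hm] := h _ (@nbhs_open_ereal_lt _ 0 (fun=> e) e0).
by exists m; exact: ltW.
Qed.

Section SkewProductFacts.
Context {R : realType} {X : pointedType} (d : X -> X -> R) {q : nat}
  (g : 'I_q.+1 -> X -> X).
Hypotheses (dmetric : is_metric d) (gcont : forall i, dcontinuous d (g i)).

Local Notation Omega := (Sigma q * XB d)%type.
Local Notation F := (@Defs.skew R X d q g).

Lemma dopen_measurable (U : set (XB d)) : dopen d U -> measurable U.
Proof. exact: sub_sigma_algebra. Qed.

Lemma dopen_preimage (f : X -> X) (U : set X) :
  dcontinuous d f -> dopen d U -> dopen d (f @^-1` U).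
Proof.
move=> fc oU x Ux; have [e e0 eU] := oU _ Ux; have [r r0 rf] := fc x e e0.
by exists r => // y xy; apply: eU; exact: rf.
Qed.

Lemma measurable_generator (i : 'I_q.+1) : measurable_fun setT (g i : XB d -> XB d).
Proof.
apply: (@measurability _ _ _ _ setT (g i : XB d -> XB d) (dopen d)) => //.
by move=> _ [U oU <-]; rewrite setTI; apply: dopen_measurable; exact: dopen_preimage.
Qed.

Lemma measurable_coord (n : nat) (i : 'I_q.+1) :
  measurable ([set w | w n = i] : set (Sigma q)).
Proof. by apply: sub_sigma_algebra; exists n, i. Qed.

Lemma measurable_shift : measurable_fun setT (@Defs.shift q.+1 : Sigma q -> Sigma q).
Proof.
apply: (@measurability _ _ _ _ setT (@Defs.shift q.+1 : Sigma q -> Sigma q) (@cylinders q.+1)) => //.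
move=> _ [U [n [i ->]] <-]; rewrite setTI; exact: (measurable_coord n.+1 i).
Qed.

Lemma measurable_skew : measurable_fun setT F.
Proof.
apply: measurable_fun_pair.
  by apply: measurableT_comp measurable_fst; exact: measurable_shift.
move=> _ A mA; rewrite setTI.
(* Split according to the first symbol: on each of these finitely many pieces a single generator
   acts. *)
have -> : (fun z : Omega => g (z.1 0%N) z.2) @^-1` A =
    \big[setU/set0]_(i < q.+1) (fst @^-1` [set w | w 0%N = i] `&` snd @^-1` (g i @^-1` A)).
  rewrite -bigcup_mkord_ord; apply/seteqP; split => z /=.
    move=> h; exists (z.1 0%N) => //=; split; first by rewrite inord_val.
    by rewrite inord_val.
  by move=> [i _ /= [e]]; rewrite e.
apply: bigsetU_measurable => i _; apply: measurableI.
  by rewrite -[X in measurable X]setTI; apply: measurable_fst => //; exact: measurable_coord.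
rewrite -[X in measurable X]setTI; apply: measurable_snd => //.
by rewrite -[X in measurable X]setTI; apply: measurable_generator.
Qed.

Definition agree (N : nat) (delta : R) (z z' : Omega) : Prop :=
  (forall n, (n < N)%N -> z.1 n = z'.1 n) /\ d z.2 z'.2 < delta.

Lemma agree_sym (N : nat) (delta : R) (z z' : Omega) :
  agree N delta z z' -> agree N delta z' z.
Proof.
have [_ _ dsym _] := dmetric.
by move=> [h1 h2]; split => [n nN|]; rewrite ?h1// dsym.
Qed.

Lemma agree_le (N N' : nat) (delta delta' : R) (z z' : Omega) :
  (N <= N')%N -> delta' <= delta -> agree N' delta' z z' -> agree N delta z z'.
Proof.
move=> NN dd [h1 h2]; split=> [n nN|]; first by apply: h1; exact: leq_trans NN.
exact: lt_le_trans dd.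
Qed.

Section Lusin.
Variable mu : probability Omega R.

(* A Lusin property: off a set of small measure, membership in [A] is locally
   constant at a uniform scale.  Unlike inner regularity by compact sets, it is
   visibly stable under complements and countable unions. *)
Definition lusin (A : set Omega) : Prop :=
  measurable A /\ forall gamma : R, 0 < gamma ->
  exists E N delta, [/\ measurable E, (mu E <= gamma%:E)%E, 0 < delta &
    forall z z', ~ E z -> ~ E z' -> agree N delta z z' -> A z -> A z'].

Lemma lusin0 : lusin set0.
Proof.
split => // e e0; exists set0, 0%N, 1; split => //.
by rewrite measure0 lee_fin ltW.
Qed.

Lemma lusinC (A : set Omega) : lusin A -> lusin (~` A).
Proof.
move=> [mA hA]; split; first exact: measurableC.
move=> e e0; have [E [N [dl [mE muE dl0 h]]]] := hA e e0.
exists E, N, dl; split => // z z' nz nz' zz' nA Az'.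
by apply: nA; apply: (h z' z) => //; exact: agree_sym.
Qed.

Lemma lusinU (A B : set Omega) : lusin A -> lusin B -> lusin (A `|` B).
Proof.
move=> [mA hA] [mB hB]; split; first exact: measurableU.
move=> e e0; have e20 : 0 < e / 2 by rewrite divr_gt0.
have [E [N [dl [mE muE dl0 h]]]] := hA _ e20.
have [E' [N' [dl' [mE' muE' dl0' h']]]] := hB _ e20.
exists (E `|` E'), (maxn N N'), (Num.min dl dl'); split.
- exact: measurableU.
- rewrite (splitr e) EFinD; apply: (le_trans (measureU2 mu mE mE')).
  exact: leeD.
- by rewrite lt_min dl0.
- move=> z z' nz nz' zz' [Az|Bz].
    left; apply: (h z) => //; [by move=> ?; apply: nz; left|by move=> ?; apply: nz'; left|].
    by apply: agree_le zz'; rewrite ?leq_maxl// ge_min lexx.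
  right; apply: (h' z) => //; [by move=> ?; apply: nz; right|by move=> ?; apply: nz'; right|].
  by apply: agree_le zz'; rewrite ?leq_maxr// ge_min lexx orbT.
Qed.

Lemma lusinI (A B : set Omega) : lusin A -> lusin B -> lusin (A `&` B).
Proof.
by move=> hA hB; rewrite -[_ `&` _]setCK setCI; apply/lusinC/lusinU; exact: lusinC.
Qed.

(** The tail of the union has small measure and joins the exceptional set; off it, only a finite
    union remains. *)
Lemma lusin_bigcup (A : nat -> set Omega) :
  (forall n, lusin (A n)) -> lusin (\bigcup_n A n).
Proof.
move=> hA; have mA n : measurable (A n) by have [] := hA n.
split; first exact: bigcup_measurable.
move=> e e0; have e20 : 0 < e / 2 by rewrite divr_gt0.
have [m hm] := measure_tail_bigcup mu mA e20.
have mm : measurable (\bigcup_(j < m) A j) by exact: bigcup_measurable.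
have [_ /(_ _ e20)[E [N [dl [mE muE dl0 h]]]]] : lusin (\bigcup_(j < m) A j).
  rewrite bigcup_mkord; elim: m {hm mm} => [|m IH]; first by rewrite big_ord0; exact: lusin0.
  by rewrite big_ord_recr; exact: lusinU.
have mT : measurable (\bigcup_n A n `\` \bigcup_(j < m) A j).
  by apply: measurableD => //; exact: bigcup_measurable.
exists (E `|` (\bigcup_n A n `\` \bigcup_(j < m) A j)), N, dl; split => //.
- exact: measurableU.
- rewrite (splitr e) EFinD; apply: (le_trans (measureU2 mu mE mT)).
  exact: leeD.
- move=> z z' nz nz' zz' Az.
  have : (\bigcup_(j < m) A j) z'.
    apply: (h z) => //; [by move=> ?; apply: nz; left|by move=> ?; apply: nz'; left|].
    by apply: contrapT => nm; apply: nz; right.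
  by move=> [j _ Aj]; exists j.
Qed.

Lemma lusin_sigma_preimage (T : Type) (f : Omega -> T) (G : set (set T)) :
  (forall A, G A -> lusin (f @^-1` A)) -> forall A, <<s G >> A -> lusin (f @^-1` A).
Proof.
move=> GA A sA.
have : [set B | lusin (f @^-1` B)] A; last by [].
move: A sA; apply: smallest_sub => //; split => /=.
- by rewrite preimage_set0; exact: lusin0.
- by move=> B hB; rewrite setTD preimage_setC; exact: lusinC.
- by move=> B hB; rewrite preimage_bigcup; exact: lusin_bigcup.
Qed.

Lemma lusin_coord (n : nat) (i : 'I_q.+1) :
  lusin ((@fst (Sigma q) (XB d)) @^-1` [set w | w n = i]).
Proof.
split.
  by rewrite -[X in measurable X]setTI; apply: measurable_fst => //; exact: measurable_coord.
move=> e e0; exists set0, n.+1, 1; split => //; first by rewrite measure0 lee_fin ltW.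
by move=> z z' _ _ [h _] /= <-; rewrite h.
Qed.

Lemma dopen_ball_not_sub (U : set X) (r : R) : dopen d (~` [set x | dball d x r `<=` U]).
Proof.
have [_ _ dsym dtri] := dmetric.
move=> x /= /existsNP[y /not_implyP[xy nUy]].
exists (r - d x y); first by rewrite subr_gt0.
move=> x' /=; rewrite /dball /= => xx' h; apply: nUy; apply: h => /=.
by have := dtri x' x y; rewrite (dsym x' x); rewrite /dball /= in xy; lra.
Qed.

(** [U] is the increasing union of the sets of points whose ball of radius [n.+1%:R^-1] lies in [U].
    Off a small tail, one radius serves all points of [U]. *)
Lemma lusin_open (U : set (XB d)) : dopen d U -> lusin ((@snd (Sigma q) (XB d)) @^-1` U).
Proof.
move=> oU; split.
  by rewrite -[X in measurable X]setTI; apply: measurable_snd => //; exact: dopen_measurable.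
move=> e e0.
pose A n : set Omega := (@snd (Sigma q) (XB d)) @^-1` [set x | dball d x n.+1%:R^-1 `<=` U].
have mA n : measurable (A n).
  rewrite -[X in measurable X]setTI; apply: measurable_snd => //.
  rewrite -[X in measurable X]setCK; apply: measurableC; apply: dopen_measurable.
  exact: dopen_ball_not_sub.
have [m hm] := measure_tail_bigcup mu mA e0.
exists (\bigcup_n A n `\` \bigcup_(j < m) A j), 0%N, m.+1%:R^-1; split => //.
  by apply: measurableD; apply: bigcup_measurable.
move=> z z' nz _ [_ zz'] /= Uz.
have [n An] : exists n, A n z.
  have [r r0 rU] := oU _ Uz.
  have [n _ /(_ n (leqnn n)) hn] := near_infty_natSinv_lt (PosNum r0).
  exists n => y; rewrite /dball /= => h; apply: rU; exact: lt_trans h hn.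
have [j jm Aj] : (\bigcup_(j < m) A j) z.
  by apply: contrapT => nm; apply: nz; split => //; exists n.
apply: Aj; rewrite /dball /=; apply: (lt_le_trans zz').
by rewrite lef_pV2 ?posrE ?ltr0n// ler_nat ltnS; exact: ltnW.
Qed.

(** The sets with the Lusin property form a sigma-algebra containing the cylinders and the open sets
    of [X], hence the measurable rectangles, hence everything. *)
Lemma measurable_lusin (A : set Omega) : measurable A -> lusin A.
Proof.
rewrite measurable_prod_measurableType => mA.
apply: (@lusin_sigma_preimage _ id _ _ _ mA) => _ [B mB [C mC <-]].
have -> : id @^-1` (B `*` C) = fst @^-1` B `&` snd @^-1` C :> set Omega by [].
apply: lusinI.
  apply: lusin_sigma_preimage mB => _ [n [i ->]]; exact: lusin_coord.
by apply: lusin_sigma_preimage mC => U; exact: lusin_open.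
Qed.

Lemma partition_lusin (P : seq (set Omega)) (gamma : R) : is_fpartition P -> 0 < gamma ->
  exists E N delta, [/\ measurable E, (mu E <= gamma%:E)%E, 0 < delta &
    forall z z' i, ~ E z -> ~ E z' -> agree N delta z z' ->
      nth set0 P i z -> nth set0 P i z'].
Proof.
move=> [mP _ _]; elim: P gamma mP => [|A P IH] e mP e0.
  exists set0, 0%N, 1; split => //; first by rewrite measure0 lee_fin ltW.
  by move=> z z' i _ _ _; rewrite nth_nil.
have e20 : 0 < e / 2 by rewrite divr_gt0.
have [|E [N [dl [mE muE dl0 h]]]] := IH _ _ e20.
  by move=> B BP; apply: mP; rewrite inE BP orbT.
have mA : measurable A by apply: mP; rewrite inE eqxx.
have [_ /(_ _ e20)[E' [N' [dl' [mE' muE' dl0' h']]]]] := measurable_lusin mA.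
exists (E `|` E'), (maxn N N'), (Num.min dl dl'); split.
- exact: measurableU.
- rewrite (splitr e) EFinD; apply: (le_trans (measureU2 mu mE mE')).
  exact: leeD.
- by rewrite lt_min dl0.
- move=> z z' [|i] nz nz' zz' /=.
    apply: h'; [by move=> ?; apply: nz; right|by move=> ?; apply: nz'; right|].
    by apply: agree_le zz'; rewrite ?leq_maxr// ge_min lexx orbT.
  apply: h; [by move=> ?; apply: nz; left|by move=> ?; apply: nz'; left|].
  by apply: agree_le zz'; rewrite ?leq_maxl// ge_min lexx.
Qed.

End Lusin.
End SkewProductFacts.

(** * Sweeping out and spanning sets *)

Lemma limn_esup_lt (R : realType) (u : nat -> \bar R) (x : \bar R) :
  (limn_esup u < x)%E -> exists L, forall l, (L <= l)%N -> (u l < x)%E.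
Proof.
move=> /ereal_inf_lt[_ [V [L _ LV] <-] h]; exists L => l Ll.
by apply: le_lt_trans h; apply: ereal_sup_ubound; exists l => //; exact: LV.
Qed.

Lemma limn_esup_le (R : realType) (u : nat -> \bar R) (x : \bar R) (L : nat) :
  (forall l, (L <= l)%N -> (u l <= x)%E) -> (limn_esup u <= x)%E.
Proof.
move=> h; apply: (@le_trans _ _ (ereal_sup (u @` [set l | (L <= l)%N]))).
  by apply: ereal_inf_lbound; exists [set l | (L <= l)%N] => //; exists L.
by apply: ge_ereal_sup => _ [l Ll <-]; exact: h.
Qed.

Lemma lne_div_lt (R : realType) (y : \bar R) (s : R) (l : nat) : (0 < l)%N ->
  (lne y * (l%:R^-1)%:E < s%:E)%E -> (y < (expR (s * l%:R))%:E)%E.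
Proof.
move=> l0; have lR : 0 < l%:R :> R by rewrite ltr0n.
case: y => [r||]; last by rewrite ltNyr.
  rewrite lte_fin; have [r0|r0] := ltP 0 r; last by rewrite (le_lt_trans r0)// expR_gt0.
  by rewrite lne_EFin// -EFinM lte_fin ltr_pdivrMr// -ltr_expR lnK ?posrE.
by rewrite /= gt0_mulye// lte_fin invr_gt0.
Qed.

Section Ergodic.
Context {R : realType} {dT : measure_display} {T : measurableType dT}.
Variables (mu : probability T R) (f : T -> T).
Hypotheses (mf : measurable_fun setT f).
Hypothesis (fmu : forall C, measurable C -> mu (f @^-1` C) = mu C).
Hypothesis (ferg : forall C, measurable C -> f @^-1` C = C -> mu C = 0%E \/ mu C = 1%E).

(** The preimages of the union [U] decrease and all have the measure of [U]. Their intersection [C]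
    is exactly invariant, as [ferg] demands, and has the same measure, which is at least [mu A] and
    so not 0. *)
Lemma ergodic_sweep (A : set T) : measurable A -> (0 < mu A)%E ->
  mu (\bigcup_n (iter n f @^-1` A)) = 1%E.
Proof.
move=> mA A0; set U := \bigcup_n _.
have mU : measurable U by apply: bigcup_measurable => n _; exact: measurable_iter.
pose V n := iter n f @^-1` U.
have mV n : measurable (V n) by exact: measurable_iter.
pose C := \bigcap_n V n.
have mC : measurable C by apply: bigcap_measurable => //; exists 0%N.
have Ufz n z : U (iter n.+1 f z) -> U (iter n f z).
  by move=> [m _ /= h]; exists m.+1 => //=; rewrite -iterS -iterSr in h *.
have Cinv : f @^-1` C = C.
  apply/seteqP; split => z /= h n _; rewrite /V /=; last first.
    by have := h n.+1 I; rewrite /V /= -iterS iterSr.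
  by have := h n I; rewrite /V /= -iterSr => /Ufz.
have Vle : {homo V : n m / (n <= m)%N >-> (m <= n)%O}.
  move=> n m; elim: m => [|m IH]; first by rewrite leqn0 => /eqP ->.
  rewrite leq_eqVlt => /predU1P[->//|nm]; apply: le_trans (IH nm).
  by apply/subsetPset => z; exact: Ufz.
have V0y : (mu (V 0%N) < +oo)%E := le_lt_trans (probability_le1 mu (mV 0%N)) (ltry 1).
have CU : mu C = mu U.
  have h := nonincreasing_cvg_mu V0y mV mC Vle.
  have e : mu \o V = cst (mu U) by apply/funext => n /=; exact: measure_iter.
  rewrite e in h; apply: cvg_unique h _ => //; exact: cvg_cst.
case: (ferg mC Cinv) => [C0|<-//].
suff : (mu A <= mu U)%E by rewrite -CU C0 leNgt A0.
by apply: le_measure; rewrite ?inE// => z Az; exists 0%N.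
Qed.

End Ergodic.

Section Words.
Context {R : realType} {X : pointedType} (d : X -> X -> R) {q : nat}
  (g : 'I_q.+1 -> X -> X).
Hypotheses (dmetric : is_metric d).

Local Notation F := (@Defs.skew R X d q g).

Lemma iter_skew1 (n k : nat) z : (iter n F z).1 k = z.1 (n + k)%N.
Proof. by elim: n k => //= n IH k; rewrite /Defs.shift IH addnS. Qed.

Lemma iter_skew2 (n : nat) z : (iter n F z).2 = orb g (mkseq z.1 n) z.2.
Proof.
elim: n => [//|n IH].
by rewrite mkseqS /orb foldl_rcons -/(orb g _ _) -IH iterS {1}/Defs.skew /= iter_skew1 addn0.
Qed.

Lemma dword_leP (w : seq 'I_q.+1) (x y : X) (e : R) : 0 <= e ->
  reflect (forall j, (j <= size w)%N -> d (orb g (take j w) x) (orb g (take j w) y) <= e)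
          (dword d g w x y <= e).
Proof.
move=> e0; apply: (iffP idP) => [/bigmax_leP[_ h] j jw|h].
  by have := h (inord j) isT; rewrite inordK.
by apply/bigmax_leP; split => // j _; apply: h; rewrite -ltnS.
Qed.

Lemma dword_sym (w : seq 'I_q.+1) (x y : X) : dword d g w x y = dword d g w y x.
Proof. by have [_ _ ds _] := dmetric; apply: eq_bigr => j _; rewrite ds. Qed.

Lemma dwordxx (w : seq 'I_q.+1) (x : X) : dword d g w x x <= 0.
Proof.
have [_ d0 _ _] := dmetric.
by apply/dword_leP => // j _; rewrite (_ : d _ _ = 0)//; apply/d0.
Qed.

Lemma orb_cat (w u : seq 'I_q.+1) (x : X) : orb g (w ++ u) x = orb g u (orb g w x).
Proof. exact: foldl_cat. Qed.

Lemma dword_orb_le (w u : seq 'I_q.+1) (x y : X) (e : R) : 0 <= e ->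
  dword d g (w ++ u) x y <= e -> dword d g u (orb g w x) (orb g w y) <= e.
Proof.
move=> e0 /(dword_leP _ _ _ e0) h; apply/dword_leP => // j ju.
have := h (size w + j)%N; rewrite size_cat leq_add2l => /(_ ju).
by rewrite take_cat ltnNge leq_addr /= addKn !orb_cat.
Qed.

Lemma sep_num_ge0 (K : set X) (w : seq 'I_q.+1) (eps : R) :
  (0 <= sep_num d g K w eps)%E.
Proof. by apply: ereal_sup_ubound; exists [::]. Qed.

(** A separated set of maximal cardinality spans, since a point far from all its elements could be
    added to it. Finiteness of [sep_num] bounds the cardinalities, so the maximum is attained. *)
Lemma max_separated_spans (K : set X) (w : seq 'I_q.+1) (eps : R) : 0 < eps ->
  (sep_num d g K w eps < +oo)%E ->
  exists2 s : seq X, ((size s)%:R%:E <= sep_num d g K w eps)%E &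
    forall x, K x -> exists2 c, c \in s & dword d g w x c <= eps.
Proof.
move=> e0 fin; have ge0 := sep_num_ge0 K w eps.
have finn : sep_num d g K w eps \is a fin_num by rewrite ge0_fin_numE.
pose Q n := `[< exists2 s, Defs.separated d g K w eps s & size s = n >].
have exQ : exists n, Q n by exists 0%N; apply/asboolP; exists [::].
have sle s : Defs.separated d g K w eps s -> ((size s)%:R%:E <= sep_num d g K w eps)%E.
  by move=> hs; apply: ereal_sup_ubound; exists s.
have ubQ n : Q n -> (n <= Num.bound (fine (sep_num d g K w eps)))%N.
  move=> /asboolP[s hs <-]; rewrite -(ler_nat R).
  apply: (@le_trans _ _ (fine (sep_num d g K w eps))).
    by rewrite -lee_fin fineK//; exact: sle.
  by apply/ltW/archi_boundP; exact: fine_ge0.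
case: (ex_maxnP exQ ubQ) => n /asboolP[s sep sn] nmax.
exists s; first exact: sle.
move=> x Kx; apply: contrapT => hx.
have far c : c \in s -> eps < dword d g w x c.
  by move=> cs; rewrite ltNge; apply/negP => h; apply: hx; exists c.
have xs : x \notin s.
  by apply/negP => /far; rewrite ltNge (le_trans (dwordxx _ _))// ltW.
have [us sK ss] := sep.
suff /nmax : Q n.+1 by rewrite ltnn.
apply/asboolP; exists (x :: s); last by rewrite /= sn.
split; first by rewrite /= xs.
  by move=> y; rewrite inE => /predU1P[->|/sK].
move=> y z; rewrite !inE => /predU1P[->|ys] /predU1P[->|zs]; rewrite ?eqxx// => yz.
- exact: far.
- by rewrite dword_sym; exact: far.
- exact: ss.
Qed.

(** For each prefix length [m <= M], collect the images under [w] of spanning sets for the words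
    [w ++ u] of length [L + m]. The factor [M.+1] counts the prefix lengths. *)
Lemma orbit_cover (K : set X) (eps a : R) (L M : nat) : 0 < eps ->
  (forall l, (L <= l)%N ->
    (\sum_(v : l.-tuple 'I_q.+1) sep_num d g K v eps < (expR (a * l%:R))%:E)%E) ->
  exists2 B : seq (seq 'I_q.+1 * X),
    (size B)%:R <= M.+1%:R * expR (a * L%:R + `|a| * M%:R) &
    forall x w u, K x -> (size w <= M)%N -> size u = L ->
      exists2 b, b \in B & b.1 = u /\ dword d g u (orb g w x) b.2 <= eps.
Proof.
move=> e0 hL.
have fin l (v : l.-tuple 'I_q.+1) : (L <= l)%N -> (sep_num d g K v eps < +oo)%E.
  move=> Ll; apply: (@le_lt_trans _ _ (\sum_(v : l.-tuple 'I_q.+1) sep_num d g K v eps)%E).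
    rewrite (bigD1 v)//= leeDl// sume_ge0// => u _; exact: sep_num_ge0.
  exact: (lt_trans (hL l Ll) (ltry _)).
(* The choice must be total on words; those used below have length at least [L], hence finite
   [sep_num]. *)
have /choice[S hS] : forall v : seq 'I_q.+1, exists s : seq X,
    (sep_num d g K v eps < +oo)%E -> ((size s)%:R%:E <= sep_num d g K v eps)%E /\
    forall x, K x -> exists2 c, c \in s & dword d g v x c <= eps.
  move=> v; have [h|h] := pselect (sep_num d g K v eps < +oo)%E; last by exists [::].
  by have [s s1 s2] := max_separated_spans e0 h; exists s.
(* Read [v] as [w ++ u] with [size w = m]: a spanning point [c] for [v] becomes the centre
   [orb g w c] for [u]. *)
pose Bv m (v : seq 'I_q.+1) := [seq (drop m v, orb g (take m v) c) | c <- S v].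
pose Bm m := flatten [seq Bv m v | v : (L + m).-tuple 'I_q.+1].
exists (flatten [seq Bm m | m <- iota 0 M.+1]); last first.
  move=> x w u Kx wM uL.
  have sz : size (w ++ u) == (L + size w)%N by rewrite size_cat uL addnC.
  have [_ /(_ x Kx)[c cS xc]] := hS (w ++ u) (fin _ (Tuple sz) (leq_addr _ _)).
  exists (u, orb g w c); last first.
    by split => //=; apply: dword_orb_le => //; exact: ltW.
  apply/flattenP; exists (Bm (size w)).
    by apply/mapP; exists (size w) => //; rewrite mem_iota.
  apply/flattenP; exists (Bv (size w) (w ++ u)).
    by apply/mapP; exists (Tuple sz) => //; rewrite mem_enum.
  by apply/mapP; exists c => //; rewrite drop_size_cat// take_size_cat.
rewrite size_flatten sumnE /shape -map_comp big_map natr_sum.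
apply: (@le_trans _ _ (\sum_(m <- iota 0 M.+1) expR (a * L%:R + `|a| * M%:R))); last first.
  by rewrite big_const_seq count_predT size_iota iter_addr_0 -[leLHS]mulr_natl.
rewrite big_seq [leRHS]big_seq; apply: ler_sum => m; rewrite mem_iota /= add0n ltnS => mM.
(* The rate [a] may be negative, whence [|a|] in the bound for the prefix. *)
apply: (@le_trans _ _ (expR (a * (L + m)%:R))); last first.
  rewrite ler_expR natrD mulrDr lerD2l (le_trans (ler_norm _))// normrM.
  by rewrite ler_wpM2l// ger0_norm// ler_nat.
rewrite -lee_fin; apply: le_trans (ltW (hL (L + m)%N (leq_addr _ _))).
rewrite size_flatten sumnE /shape -map_comp big_map natr_sum -sumEFin big_enum /=.
by apply: lee_sum => v _; rewrite size_map; have [] := hS v (fin _ v (leq_addr _ _)).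
Qed.

End Words.

(** * The entropy inequality *)

Lemma le_limn_esup (R : realType) (u v : nat -> \bar R) :
  (forall n, (u n <= v n)%E) -> (limn_esup u <= limn_esup v)%E.
Proof.
move=> uv; apply: le_ereal_inf_tmp => _ [V hV <-].
apply: (@le_trans _ _ (ereal_sup (u @` V))).
  by apply: ereal_inf_lbound; exists V.
apply: ge_ereal_sup => _ [n Vn <-]; apply: (le_trans (uv n)).
by apply: ereal_sup_ubound; exists n.
Qed.

Lemma S_d_antitone (R : realType) (X : pointedType) (d : X -> X -> R) (q : nat)
    (g : 'I_q.+1 -> X -> X) (K : set X) (eps eps' : R) :
  eps <= eps' -> (S_d d g K eps' <= S_d d g K eps)%E.
Proof.
move=> ee; apply: le_limn_esup => n; apply: lee_wpmul2r; first by rewrite lee_fin invr_ge0.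
have p0 : (0 <= ((q.+1%:R : R) ^- n)%:E)%E by rewrite lee_fin invr_ge0 exprn_ge0.
have S0 e : (0 <= S_n d g K e n)%E.
  by rewrite mule_ge0// sume_ge0// => w _; exact: sep_num_ge0.
rewrite lee_lne ?in_itv /= ?leey ?andbT//.
apply: lee_wpmul2l => //; apply: lee_sum => w _.
apply: ge_ereal_sup => _ [s [us sK ss] <-]; apply: ereal_sup_ubound.
by exists s => //; split => // x y xs ys xy; exact: le_lt_trans ee (ss _ _ xs ys xy).
Qed.

(** Undoing the average over the [q.+1 ^ l] words adds [ln q.+1%:R] to the rate. *)
Lemma S_d_lt_sep_num (R : realType) (X : pointedType) (d : X -> X -> R) (q : nat)
    (g : 'I_q.+1 -> X -> X) (K : set X) (eps s : R) :
  (S_d d g K eps < s%:E)%E -> exists L, forall l, (L <= l)%N ->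
    (\sum_(v : l.-tuple 'I_q.+1) sep_num d g K v eps <
      (expR ((ln q.+1%:R + s) * l%:R))%:E)%E.
Proof.
(* The successor keeps [l] positive, so that multiplying through by [l] is legitimate. *)
move=> /limn_esup_lt[L hL]; exists L.+1 => l Ll.
have p0 : 0 < (q.+1%:R : R) ^+ l by rewrite exprn_gt0.
have := lne_div_lt (leq_ltn_trans (leq0n L) Ll) (hL l (ltnW Ll)).
rewrite /S_n lte_pdivrMl// => /lt_le_trans; apply.
by rewrite -EFinM lee_fin mulrDl expRD (expRM_natr _ (ln _)) lnK ?posrE.
Qed.

Section Main.
Context {R : realType} {X : pointedType} (d : X -> X -> R) {q : nat}
  (g : 'I_q.+1 -> X -> X).
Hypotheses (dmetric : is_metric d) (gcont : forall i, dcontinuous d (g i)).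
Variable nu : probability (XB d) R.

Local Notation Omega := (Sigma q * XB d)%type.
Local Notation F := (@Defs.skew R X d q g).

Lemma measurable_orb (w : seq 'I_q.+1) : measurable_fun setT (orb g w : XB d -> XB d).
Proof.
elim/last_ind: w => [|w i IH]; first exact: measurable_id.
have -> : orb g (rcons w i) = g i \o orb g w by apply/funext => x; exact: foldl_rcons.
by apply: measurableT_comp IH; exact: measurable_generator.
Qed.

Lemma measurable_dball_le (c : X) (e : R) : measurable ([set x | d x c <= e] : set (XB d)).
Proof.
have [_ _ dsym dtri] := dmetric.
rewrite -[X in measurable X]setCK; apply: measurableC; apply: dopen_measurable.
move=> x /= /negP; rewrite -ltNge => xc; exists (d x c - e); first by rewrite subr_gt0.
move=> y; rewrite /dball /= => xy; apply/negP; rewrite -ltNge.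
by have := dtri x y c; lra.
Qed.

Lemma measurable_dword_le (u : seq 'I_q.+1) (c : X) (e : R) : 0 <= e ->
  measurable ([set x | dword d g u x c <= e] : set (XB d)).
Proof.
move=> e0.
have -> : [set x | dword d g u x c <= e] = \bigcap_(j in `I_(size u).+1)
    (orb g (take j u) @^-1` [set y | d y (orb g (take j u) c) <= e]) :> set (XB d).
  apply/seteqP; split => x /=.
    by move=> /(dword_leP _ _ _ _ _ e0) h j /= ju; apply: h.
  by move=> h; apply/(dword_leP _ _ _ _ _ e0) => j ju; exact: (h j).
apply: bigcap_measurable => [|j _]; first by exists 0%N.
by rewrite -[X in measurable X]setTI; apply: measurable_orb => //; exact: measurable_dball_le.
Qed.

(** By [ergodic_sweep], up to measure [e] every orbit meets [K] before some time [m]; then at time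
    [m] its position is the image of a point of [K] under a word of length at most [m]. The images
    enter through measurable supersets [W], which avoids asking whether they are Borel
    themselves. *)
Lemma ergodic_orbit_hull (mu0 : probability Omega R) (K : set (XB d)) (e : R) :
  Pi_erg g nu mu0 -> measurable K -> (0 < nu K)%E -> 0 < e ->
  exists M, forall W : set (XB d), measurable W ->
    (forall x w, K x -> (size w <= M)%N -> W (orb g w x)) -> (nu (~` W) <= e%:E)%E.
Proof.
move=> [[inv _ marg] erg] mK K0 e0; have mF := measurable_skew gcont.
have msnd (A : set (XB d)) : measurable A -> measurable ((@snd (Sigma q) (XB d)) @^-1` A).
  by move=> mA; rewrite -[X in measurable X]setTI; exact: measurable_snd.
pose A j : set Omega := iter j F @^-1` (snd @^-1` K).
have mA j : measurable (A j) by apply: measurable_iter => //; exact: msnd.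
have U1 : mu0 (\bigcup_j A j) = 1%E.
  by apply: ergodic_sweep => //; [exact: msnd|rewrite marg].
have mU : measurable (\bigcup_j A j) by exact: bigcup_measurable.
have [m hm] := measure_tail_bigcup mu0 mA e0.
exists m => W mW KW; have mWC := measurableC mW.
have mD : measurable (\bigcup_j A j `\` \bigcup_(j < m) A j).
  by apply: measurableD => //; exact: bigcup_measurable.
(* Invariance of [mu0] allows the complement of [W] to be measured at time [m]. *)
rewrite -marg// -(measure_iter mF inv m); last exact: msnd.
apply: (@le_trans _ _ (mu0 (~` (\bigcup_j A j) `|`
    (\bigcup_j A j `\` \bigcup_(j < m) A j)))).
  apply: le_measure; rewrite ?inE.
  - by apply: measurable_iter => //; exact: msnd.
  - by apply: measurableU => //; exact: measurableC.
  move=> z /= nW; have [Uz|] := pselect ((\bigcup_j A j) z); last by left.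
  right; split => // -[j /= jm Kz]; apply: nW.
  rewrite -(subnK (ltnW jm)) iterD iter_skew2; apply: KW => //.
  by rewrite size_mkseq leq_subr.
have mUC := measurableC mU.
apply: (le_trans (measureU2 mu0 mUC mD)).
have UC0 : mu0 (~` (\bigcup_j A j)) = 0%E by rewrite probability_setC// U1 subee.
by rewrite -[leRHS]add0e; apply: leeD hm; rewrite -[leRHS]UC0.
Qed.

(** The balls of [orbit_cover] feed [part_entropy_le_cover]. The hull hypothesis concerns only [nu],
    so it bounds the uncovered part for every [mu] with marginal [nu]. *)
Lemma part_entropy_le_sep (mu : probability Omega R) (P : seq (set Omega))
    (E : set Omega) (N M n : nat) (delta eps a t eta : R) (K : set (XB d)) :
  Pi_set g nu mu -> is_fpartition P -> measurable E ->
  (forall z z' i, ~ E z -> ~ E z' -> agree N delta z z' ->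
      nth set0 P i z -> nth set0 P i z') ->
  0 < eps -> eps + eps < delta -> 0 < t <= 1 -> K !=set0 ->
  (forall W : set (XB d), measurable W ->
    (forall x w, K x -> (size w <= M)%N -> W (orb g w x)) -> (nu (~` W) <= eta%:E)%E) ->
  (forall l, (n + N <= l)%N ->
    (\sum_(v : l.-tuple 'I_q.+1) sep_num d g K v eps < (expR (a * l%:R))%:E)%E) ->
  part_entropy mu (iter_join F P n) <=
    ln 2 + ln M.+1%:R + `|a| * (N + M)%:R
    + n%:R * (a + (size P)%:R * t - ln t * fine (mu E) + ln (size P)%:R * eta).
Proof.
move=> [inv _ marg] Ppart mE hE e0 e2 t01 [x0 Kx0] hull hl.
have [_ _ dsym dtri] := dmetric.
have [B szB Bcov] := orbit_cover dmetric M e0 hl.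
(* The extra [N] symbols ensure that at each time [j < n] the next [N] symbols are still
   determined. *)
pose L := (n + N)%N.
pose ball b (z : Omega) := mkseq z.1 L = b.1 /\ dword d g b.1 z.2 b.2 <= eps.
(* Quantifying over all words [u] makes [W] a condition on the point of [X] alone, whatever its
   symbol sequence. *)
pose W : set (XB d) := [set x | forall u : L.-tuple 'I_q.+1,
  exists2 b, b \in B & b.1 = u /\ dword d g u x b.2 <= eps].
have mW : measurable W.
  have -> : W = \bigcap_(u in [set: L.-tuple 'I_q.+1]) \bigcup_(b in [set` B])
      [set x | b.1 = u /\ dword d g u x b.2 <= eps].
    apply/seteqP; split => x /=.
      by move=> h u _; have [b bB hb] := h u; exists b.
    by move=> h u; have [b bB hb] := h u I; exists b.
  apply: fin_bigcap_measurable; first exact: finite_finset.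
  move=> u _; apply: fin_bigcup_measurable; first exact: finite_seq.
  move=> b _; have [e|ne] := pselect (b.1 = u).
    have -> : [set x | b.1 = u /\ dword d g u x b.2 <= eps] =
        [set x | dword d g u x b.2 <= eps] :> set (XB d).
      by apply/seteqP; split => x /=; [case|].
    by apply: measurable_dword_le; exact: ltW.
  have -> : [set x | b.1 = u /\ dword d g u x b.2 <= eps] = set0 :> set (XB d).
    by apply/seteqP; split => x //= -[].
  exact: measurable0.
have WK x w : K x -> (size w <= M)%N -> W (orb g w x).
  move=> Kx wM u; exact: Bcov (size_tuple u).
have nuW := hull W mW WK.
pose G : set Omega := snd @^-1` W.
have mG : measurable G by rewrite -[X in measurable X]setTI; exact: measurable_snd.
(* Two points of the same ball [agree] at all times up to time [n], so all points of
   the ball that are outside [E] at time [j] lie in the same cell at time [j]. *)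
have /choice[r hr] : forall bj : (seq 'I_q.+1 * X) * nat, exists i,
    (bj.2 < n)%N -> forall z, ball bj.1 z -> ~ E (iter bj.2 F z) ->
      nth set0 P i (iter bj.2 F z).
  move=> [b j] /=; case: (ltnP j n) => jn; last by exists 0%N.
  have [[z' [bz' nEz']]|no] := pselect (exists z, ball b z /\ ~ E (iter j F z)); last first.
    by exists 0%N => _ z bz nEz; exfalso; apply: no; exists z.
  have [idx idxP] := part_index Ppart.
  exists (idx (iter j F z')) => _ z bz nEz.
  have [_ h' _] := idxP (iter j F z'); apply: hE h' => //.
  have [z1 /(dword_leP _ _ _ _ _ (ltW e0)) z2] := bz.
  have [z1' /(dword_leP _ _ _ _ _ (ltW e0)) z2'] := bz'.
  have jL : (j <= L)%N by rewrite (leq_trans (ltnW jn))// leq_addr.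
  have zz' m : (m < L)%N -> z'.1 m = z.1 m.
    by move=> mL; rewrite -(nth_mkseq ord0 z'.1 mL) -(nth_mkseq ord0 z.1 mL) z1 z1'.
  split => [m mN|].
    rewrite !iter_skew1; apply: zz'; rewrite /L.
    by rewrite (leq_trans _ (leq_add (ltnW jn) mN))// addnS.
  have bj (y : Omega) : mkseq y.1 L = b.1 -> take j b.1 = mkseq y.1 j.
    by move=> <-; rewrite /mkseq -map_take take_iota (minn_idPl jL).
  rewrite !iter_skew2 -(bj z z1) -(bj z' z1').
  have bs : (j <= size b.1)%N by rewrite -z1 size_mkseq.
  apply: (le_lt_trans (dtri _ (orb g (take j b.1) b.2) _)).
  apply: le_lt_trans e2; apply: lerD; first exact: z2'.
  by rewrite dsym; exact: z2.
have B0 : (0 < size B)%N.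
  have [b bB _] := Bcov x0 [::] (nseq L ord0) Kx0 (leq0n _) (size_nseq _ _).
  by case: (B) bB.
have mF := measurable_skew gcont.
apply: (le_trans (@part_entropy_le_cover _ _ _ mu F P mF Ppart inv _ B
  (fun b j => r (b, j)) E G t n mE mG t01 B0 _)).
  move=> z Gz; have szL : size (mkseq z.1 L) == L by rewrite size_mkseq.
  have [b bB [b1 b2]] := Gz (Tuple szL).
  exists b => // j jn nE; apply: (hr (b, j)) => //; split => //=.
  by rewrite b1.
have lnB : ln (size B)%:R <= ln M.+1%:R + (a * (n + N)%:R + `|a| * M%:R).
  rewrite -[X in _ <= _ + X]expRK -lnM ?posrE ?expR_gt0// ler_ln ?posrE ?ltr0n//.
  by rewrite mulr_gt0 ?expR_gt0.
(* Only [a * n%:R] must keep its sign; the contributions of [N] and [M] do not grow with [n]. *)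
have aN : a * N%:R <= `|a| * N%:R by rewrite ler_wpM2r// ler_norm.
have muG : n%:R * ln (size P)%:R * fine (mu (~` G)) <= n%:R * (ln (size P)%:R * eta).
  rewrite -mulrA ler_wpM2l// ler_wpM2l//.
    have [idx /(_ point)[h _ _]] := part_index Ppart.
    by rewrite ln_ge0// ler1n; exact: leq_ltn_trans h.
  have -> : mu (~` G) = nu (~` W) by rewrite -marg//; exact: measurableC.
  by rewrite -lee_fin fineK// fin_num_measure//; exact: measurableC.
move: lnB aN muG; rewrite !natrD !mulrDr; lra.
Qed.

(** The order of choices matters: [t], [gamma], [E], [N] and [delta] depend only on [mu], [P] and
    [e], so [eps0] is uniform in [K]. Then [eta] controls the hull of [K], whose word length [M]
    depends on [K], as does the threshold [n0]. *)
Lemma entropy_part_le_S_d (mu mu0 : probability Omega R) (P : seq (set Omega)) (e : R) :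
  Pi_erg g nu mu0 -> Pi_set g nu mu -> is_fpartition P -> 0 < e ->
  exists2 eps0 : R, 0 < eps0 & forall (eps : R) (K : set (XB d)),
    0 < eps < eps0 -> measurable K -> (0 < nu K)%E ->
    (entropy_part mu F P <= S_d d g K eps + (ln q.+1%:R + e)%:E)%E.
Proof.
move=> mu0erg muPi Ppart e0.
pose k : R := (size P)%:R.
have k0 : 0 <= k by rewrite ler0n.
(* One quarter each for [k * t], for the visits to [E], for the uncovered set and for the constant
   [C] divided by [n]. The summands [e4] and 1 in the denominators below keep them positive. *)
pose e4 := e / 4.
have e40 : 0 < e4 by rewrite divr_gt0.
pose t := e4 / (k + e4).
have ke0 : 0 < k + e4 by rewrite ltr_wpDl.
have t0 : 0 < t by rewrite divr_gt0.
have t1 : t <= 1 by rewrite ler_pdivrMr// mul1r lerDr.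
have kt : k * t <= e4.
  by rewrite mulrCA; apply: ler_piMr; [exact: ltW|rewrite ler_pdivrMr// mul1r lerDl ltW].
have lnt : 0 <= - ln t by rewrite oppr_ge0 ln_le0.
have lnt1 : 0 < 1 - ln t by rewrite ltr_wpDr.
pose gamma := e4 / (1 - ln t).
have gamma0 : 0 < gamma by rewrite divr_gt0.
have [E [N [delta [mE muE delta0 hE]]]] := partition_lusin dmetric mu Ppart gamma0.
exists (delta / 2); first by rewrite divr_gt0.
move=> eps K /andP[eps0 epsd] mK K0.
have lnk : 0 <= ln k.
  have [idx /(_ point)[h _ _]] := part_index Ppart.
  by rewrite ln_ge0// ler1n; exact: leq_ltn_trans h.
have lnk1 : 0 < 1 + ln k by rewrite ltr_wpDr.
pose eta := e4 / (1 + ln k).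
have eta0 : 0 < eta by rewrite divr_gt0.
have [M hM] := ergodic_orbit_hull mu0erg mK K0 eta0.
have Kne : K !=set0.
  apply/set0P/eqP => K_; by rewrite K_ measure0 ltxx in K0.
(* Testing against real [s] above [S_d] handles its infinite values as well. *)
suff H s : (S_d d g K eps < s%:E)%E -> (entropy_part mu F P <= (s + (ln q.+1%:R + e))%:E)%E.
  case: (S_d d g K eps) H => [r||] H.
  - apply/lee_addgt0Pr => e' e'0; rewrite -!EFinD addrAC; apply: H.
    by rewrite lte_fin ltrDl.
  - by rewrite addye// leey.
  - rewrite addNye leeNy_eq; apply/eqP/eq_ninfty => A.
    have := H (A - (ln q.+1%:R + e)); rewrite subrK; apply; exact: ltNyr.
move=> /S_d_lt_sep_num; set a := ln _ + s => -[L hL].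
pose C := ln 2 + ln M.+1%:R + `|a| * (N + M)%:R.
have C0 : 0 <= C by rewrite !addr_ge0 ?mulr_ge0// ?ln_ge0 ?ler1n.
pose n0 := (maxn L (Num.bound (C / e4))).+1.
apply: (@limn_esup_le _ _ _ n0) => n n0n; rewrite lee_fin.
have n1 : (0 < n)%N by exact: leq_ltn_trans n0n.
have nR : 0 < n%:R :> R by rewrite ltr0n.
have Cn : C <= e4 * n%:R.
  rewrite mulrC -ler_pdivrMr//; apply: (@le_trans _ _ (Num.bound (C / e4))%:R).
    by apply/ltW/archi_boundP; rewrite divr_ge0// ltW.
  by rewrite ler_nat (leq_trans _ (ltnW n0n))// leq_maxr.
have t01 : 0 < t <= 1 by rewrite t0.
rewrite ler_pdivrMr//.
apply: (le_trans (part_entropy_le_sep muPi Ppart mE hE eps0 _ t01 Kne hM (a := a) (n := n) _)).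
- by rewrite [ltRHS](splitr delta) ltrD.
- move=> l hl; apply: hL; apply: leq_trans hl; rewrite (leq_trans _ (leq_addr _ _))//.
  by rewrite (leq_trans _ (ltnW n0n))// leq_maxl.
have gE : - ln t * fine (mu E) <= e4.
  apply: (@le_trans _ _ (- ln t * gamma)).
    by rewrite ler_wpM2l// -lee_fin fineK// fin_num_measure.
  by rewrite mulrCA; apply: ler_piMr; [exact: ltW|rewrite ler_pdivrMr// mul1r; lra].
have kE : ln k * eta <= e4.
  by rewrite mulrCA; apply: ler_piMr; [exact: ltW|rewrite ler_pdivrMr// mul1r; lra].
have : n%:R * (a + k * t - ln t * fine (mu E) + ln k * eta) <=
       n%:R * (a + e4 + e4 + e4).
  by rewrite ler_wpM2l// !lerD// -mulNr.
have e4E : e = e4 + e4 + e4 + e4 by rewrite /e4; lra.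
rewrite -/C -/k => h; apply: (le_trans (lerD Cn h)); rewrite {1}e4E /a; lra.
Qed.

End Main.

(* The number of generators is p = q.+1 >= 1; generators g_1..g_p are g 0 .. g q. *)
Theorem theoremB (R : realType) (X : pointedType) (d : X -> X -> R) (q : nat)
    (g : 'I_q.+1 -> X -> X) (nu : probability (XB d) R) :
  is_metric d -> dcompact d -> (forall i, dcontinuous d (g i)) ->
  Pi_erg g nu !=set0 ->
  (h_nu g nu <=
     limf_einf (fun eps : R =>
        ereal_inf [set S_d d g K eps |
                   K in [set K : set (XB d) | measurable K /\ (0 < nu K)%E]])
       ((0 : R)^'+))%E
  /\ (forall K : set (XB d), measurable K -> (0 < nu K)%E ->
        (h_nu g nu <= h_top d g K)%E).
Proof.
move=> dmetric _ gcont [mu0 mu0erg].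
(* Both suprema, over measures and over partitions, are bounded member by member, with an error [e]
   that tends to 0. *)
have reduce Y : (forall (mu : probability (Sigma q * XB d)%type R) P (e : R),
      Pi_set g nu mu -> is_fpartition P -> 0 < e ->
      (entropy_part mu (@Defs.skew R X d q g) P <= Y + (ln q.+1%:R + e)%:E)%E) ->
    (h_nu g nu <= Y)%E.
  move=> h; rewrite /h_nu leeBlDr//; apply: ge_ereal_sup => _ [mu muPi <-].
  apply: ge_ereal_sup => _ [P Ppart <-]; apply/lee_addgt0Pr => e e0.
  by rewrite -addeA -EFinD; exact: h.
split => [|K mK K0]; apply: reduce => mu P e muPi Ppart e0.
  have [eps0 eps00 H] := entropy_part_le_S_d dmetric gcont mu0erg muPi Ppart e0.
  (* The lower limit is a supremum of infima over the sets of the filter; the interval from 0 to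
     [eps0] is a witness because [H] is uniform in [K]. *)
  rewrite -leeBlDr// limf_einfE; apply: le_trans (ereal_sup_ubound _); last first.
    exists [set eps : R | 0 < eps < eps0]; last reflexivity.
    near=> eps => /=; apply/andP; split => //.
  apply: le_ereal_inf_tmp => _ [eps /= epsP <-].
  by apply: le_ereal_inf_tmp => _ [K [mK K0] <-]; rewrite EFinN leeBlDr//; exact: H.
have [eps0 eps00 H] := entropy_part_le_S_d dmetric gcont mu0erg muPi Ppart e0.
(* Monotonicity in [eps] turns the limit at 0 into a supremum, so the single scale [eps0 / 2]
   suffices. *)
have lim : h_top d g K = ereal_sup [set S_d d g K eps | eps in [set` `]0, +oo[]].
  apply: cvg_lim => //; apply: (nonincreasing_at_right_cvge +oo%O) => //.
  by move=> x y _ _; exact: S_d_antitone.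
have eps2 : 0 < eps0 / 2 < eps0 by rewrite divr_gt0// ltr_pdivrMr//; lra.
apply: (le_trans (H _ _ eps2 mK K0)); rewrite leeD2r// lim.
apply: ereal_sup_ubound; exists (eps0 / 2) => //=.
by rewrite in_itv /= andbT divr_gt0.
Unshelve. all: by end_near. Qed.
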